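(* Let $p$ be a prime, $q=p^e$, and let $A=\mathbb{Z}_{n_1}\times\cdots\times\mathbb{Z}_{n_h}$ be an abelian group of exponent $N$ with $\gcd(N,q)=1$. Let $m=\mathrm{ord}_N(q)$ and for each $\ell\in[h]$ let $\gamma_\ell$ be a primitive $n_\ell$-th root of unity in $\mathbb{F}_{q^m}$. Let $(s_{i,1},\dots,s_{i,h})\in A$ for $1\le i\le k$, and let $C\subseteq\mathbb{F}_q[A]$ be the code \[C=\Big\{\Big(\mathrm{Tr}_{q^m/q}\Big(\sum_{i=1}^k\alpha_i\prod_{\ell=1}^h\gamma_\ell^{s_{i,\ell}j_\ell}\Big)\Big)_{(j_1,\dots,j_h)\in A}:(\alpha_1,\dots,\alpha_k)\in\mathbb{F}_{q^m}^k\Big\}.\] Then the $p$-adic valuation of $C$ equals the minimum of $\frac{1}{p-1}\sum_{i=1}^kS_p(r_i)-e$ over all $\boldsymbol{r}=(r_1,\dots,r_k)\in[0,q^m-1]^k$ such that $|\boldsymbol{r}|=\sum_ir_i>0$, $|\boldsymbol{r}|\equiv0\pmod{q-1}$, and $\sum_{i=1}^k r_is_{i,\ell}\equiv0\pmod{n_\ell}$ for all $1\le\ell\le h$.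
   Context: The $p$-adic valuation of a linear code over $\mathbb{F}_q$ is the greatest integer $t$ such that the Hamming weight of every codeword is divisible by $p^t$. $S_p(a)$ is the sum of the base-$p$ digits of $a$; $[a,b]=\{i\in\mathbb{Z}:a\le i\le b\}$, $[h]=[1,h]$. $\mathrm{Tr}_{q^m/q}$ is the trace from $\mathbb{F}_{q^m}$ to $\mathbb{F}_q$. *)

(* Defs.v *)
From HB Require Import structures.
From mathcomp Require Import all_boot all_order all_algebra all_field.
Set Implicit Arguments. Unset Strict Implicit. Unset Printing Implicit Defensive.
Import Order.TTheory GRing.Theory Num.Theory.

Definition grp (h : nat) (n : 'I_h -> nat) : finType :=
  {dffun forall l : 'I_h, 'I_(n l)}.

(* Sum of the base-p digits of a (p >= 2): the i-th digit is (a %/ p^i) %% p,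
   and all digits of index > a vanish. *)
Definition digsum (p a : nat) : nat := \sum_(i < a.+1) ((a %/ p ^ i) %% p).

Definition is_mult_order (N q m : nat) : Prop :=
  [/\ 0 < m, q ^ m = 1 %[mod N] &
      forall m', 0 < m' -> q ^ m' = 1 %[mod N] -> m <= m'].

Definition trace (L : finFieldType) (q m : nat) (x : L) : L :=
  (\sum_(i < m) x ^+ (q ^ i))%R.

Definition hweight (I : finType) (L : finFieldType) (c : I -> L) : nat :=
  #|[set j : I | c j != 0%R]|.

(* t is the p-adic valuation of a code whose codewords are indexed by X with
   weight function w: the greatest t such that p^t divides every weight. *)
Definition is_padic_valuation (X : Type) (p : nat) (w : X -> nat) (t : nat) : Prop :=
  (forall x, p ^ t %| w x) /\
  (forall t', (forall x, p ^ t' %| w x) -> t' <= t).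

(* Main.v *)
(* Fix a place from Q(zeta_p, zeta_(Q-1)), Q = q^m, to L, let T be the
   Teichmuller lift, Psi a nontrivial additive character of L, pi = zeta_p - 1.
   On L, Psi is a polynomial in T of degree < Q whose coefficients are
   normalized Gauss sums, and Stickelberger's theorem gives the r-th one
   the exact valuation S_p(r) in units of pi.  For the latter: the Gauss sum
   g_r divides pi^(S_p(r)) by induction on r (Jacobi sums are integral, g_(pr)
   = g_r, and g_1 is pi times a unit), and g_r g_(Q-1-r) = +-Q is a unit times
   pi^(S_p(r) + S_p(Q-1-r)), so equality must hold.
   Counting zeros of codewords with Psi, orthogonality leaves exactly the
   admissible_exp exponents: q times the weight at alpha is, up to a unit, the sum
   over admissible_exp r of the products of coefficients times T(alpha)^r.  This
   bounds all weights; after division by the least power of pi, it reduces to a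
   nonzero polynomial over L of degree < Q in each variable, which cannot vanish
   at all alpha. *)
Require Import Defs.
From HB Require Import structures.
From mathcomp Require Import all_boot all_order all_algebra all_field.
From mathcomp Require Import cyclic zify ring.
Import Order.TTheory GRing.Theory Num.Theory.
Set Implicit Arguments. Unset Strict Implicit. Unset Printing Implicit Defensive.

(** * Digit sums *)

Lemma digsum_trunc p a N : 1 < p -> a < p ^ N ->
  digsum p a = \sum_(i < N) ((a %/ p ^ i) %% p).
Proof.
move=> p_gt1.
(* Digits of index at least [M] vanish once [a < p ^ M], so any two sufficient lengths give the same
   sum. *)
have widen M M' : a < p ^ M -> M <= M' ->
    \sum_(i < M) ((a %/ p ^ i) %% p) = \sum_(i < M') ((a %/ p ^ i) %% p).
  move=> aM leM; rewrite -!(big_mkord xpredT (fun i => (a %/ p ^ i) %% p)).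
  rewrite [RHS](@big_cat_nat _ _ _ M) //= [X in _ = _ + X]big_nat_cond.
  rewrite [X in _ = _ + X]big1 ?addn0 // => i; rewrite andbT => /andP[leMi _].
  by rewrite divn_small ?mod0n // (leq_trans aM) // leq_exp2l.
have aa : a < p ^ a.+1 by apply: ltn_trans (ltn_expl a p_gt1) _; rewrite ltn_exp2l.
move=> aN; rewrite /digsum; case: (leqP N a.+1) => leN.
  by rewrite (widen _ _ aN leN).
by rewrite (widen _ _ aa (ltnW leN)).
Qed.

Lemma digsum_rec p a : 1 < p -> digsum p a = a %% p + digsum p (a %/ p).
Proof.
move=> p_gt1; have aa : a < p ^ a.+1.
  by apply: ltn_trans (ltn_expl a p_gt1) _; rewrite ltn_exp2l.
rewrite (@digsum_trunc _ _ a.+2) //; last by rewrite (ltn_trans aa) // ltn_exp2l.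
rewrite (@digsum_trunc _ _ a.+1) //; last by apply: leq_ltn_trans (leq_div _ _) aa.
rewrite big_ord_recl expn0 divn1; congr (_ + _).
by apply: eq_bigr => i _; rewrite expnS divnMA.
Qed.

Lemma digsum0 p : digsum p 0 = 0.
Proof. by rewrite /digsum big_ord1 div0n mod0n. Qed.

Lemma digsumMp p a : 1 < p -> digsum p (p * a) = digsum p a.
Proof. by move=> p1; rewrite digsum_rec // modnMr mulKn // ltnW. Qed.

(** The last digit of [a] is not [p - 1], so adding 1 causes no carry. *)
Lemma digsumS p a : 1 < p -> ~~ (p %| a.+1) -> digsum p a.+1 = (digsum p a).+1.
Proof.
move=> p1 ndvd; rewrite digsum_rec // [digsum p a]digsum_rec //.
rewrite modnS divnS ?(negPf ndvd) ?(ltnW p1) //=.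
Qed.

(** All [f] digits of [p ^ f - 1] are [p - 1], so the digits of [a] and [b] are complementary
    position by position. *)
Lemma digsum_compl p f a b : 1 < p -> (a + b).+1 = p ^ f ->
  digsum p a + digsum p b = f * (p - 1).
Proof.
move=> p1; elim: f a b => [|f IH] a b.
  by rewrite expn0 => -[] /eqP; rewrite addn_eq0 => /andP[/eqP-> /eqP->]; rewrite digsum0.
rewrite expnS => Eab; rewrite (digsum_rec a) // (digsum_rec b) //.
have p0 := ltnW p1.
have ap := ltn_pmod a p0; have bp := ltn_pmod b p0.
have Ea := divn_eq a p; have Eb := divn_eq b p.
(* This is a multiple of [p] lying strictly between 0 and [2p]. *)
have Em : a %% p + b %% p + 1 = p.
  have D : p %| a %% p + b %% p + 1.
    rewrite -(dvdn_addr _ (dvdn_mulr (a %/ p + b %/ p) (dvdnn p))).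
    suff ->: p * (a %/ p + b %/ p) + (a %% p + b %% p + 1) = p * p ^ f by rewrite dvdn_mulr.
    by rewrite -Eab {3}Ea {3}Eb; lia.
  case/dvdnP: D => c Ec.
  have c2 : c < 2 by rewrite -(ltn_pmul2r p0); lia.
  have c0 : 0 < c by rewrite lt0n; apply/eqP=> c0; move: Ec; rewrite c0; lia.
  have c1 : c = 1 by lia.
  by rewrite Ec c1 mul1n.
have Ed : (a %/ p + b %/ p).+1 = p ^ f.
  have: p * (a %/ p + b %/ p).+1 = p * p ^ f by rewrite -Eab {2}Ea {2}Eb; lia.
  by move/eqP; rewrite eqn_pmul2l // => /eqP.
by rewrite addnACA (IH _ _ Ed); lia.
Qed.

Local Open Scope ring_scope.

(** * Places *)

(* The graph of a homomorphism onto its residue field, defined on a local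
   subring of K. *)
Record place (K L : fieldType) := Place {
  red :> K -> L -> Prop;
  red_fun : forall x u v, red x u -> red x v -> u = v;
  red1 : red 1 1;
  redB : forall x y u v, red x u -> red y v -> red (x - y) (u - v);
  redM : forall x y u v, red x u -> red y v -> red (x * y) (u * v);
  redV : forall x u, red x u -> u != 0 -> red x^-1 u^-1
}.

Section PlaceTheory.
Variables (K L : fieldType) (R : place K L).

Lemma red0 : R 0 0.
Proof. by rewrite -(subrr 1) -[X in R _ X](subrr 1); apply: redB; apply: red1. Qed.

Lemma redN x u : R x u -> R (- x) (- u).
Proof. by move=> Rx; rewrite -(sub0r x) -(sub0r u); apply: redB => //; apply: red0. Qed.

Lemma redD x y u v : R x u -> R y v -> R (x + y) (u + v).
Proof.
by move=> Rx Ry; rewrite -[y]opprK -[v]opprK; apply: redB => //; apply: redN.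
Qed.

Lemma red_sum (I : Type) (r : seq I) (P : pred I) (F : I -> K) (G : I -> L) :
  (forall i, P i -> R (F i) (G i)) ->
  R (\sum_(i <- r | P i) F i) (\sum_(i <- r | P i) G i).
Proof.
move=> H; elim/big_rec2: _ => [|i u x Pi Rux]; first exact: red0.
by apply: redD => //; apply: H.
Qed.

Lemma red_prod (I : Type) (r : seq I) (P : pred I) (F : I -> K) (G : I -> L) :
  (forall i, P i -> R (F i) (G i)) ->
  R (\prod_(i <- r | P i) F i) (\prod_(i <- r | P i) G i).
Proof.
move=> H; elim/big_rec2: _ => [|i u x Pi Rux]; first exact: red1.
by apply: redM => //; apply: H.
Qed.

Lemma redX x u n : R x u -> R (x ^+ n) (u ^+ n).
Proof.
move=> Rx; rewrite -(card_ord n) -!prodr_const; exact: red_prod.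
Qed.

Lemma red_nat n : R n%:R n%:R.
Proof. by rewrite -(card_ord n) -!sumr_const; apply: red_sum => i _; apply: red1. Qed.

Lemma red_neq0 x u : R x u -> u != 0 -> x != 0.
Proof.
move=> Rx; apply: contra => /eqP x0; move: Rx; rewrite x0 => R0.
by rewrite (red_fun R0 red0).
Qed.

Lemma red_eq0 u : R 0 u -> u = 0.
Proof. by move=> R0; apply: red_fun R0 red0. Qed.

End PlaceTheory.

(** * Places of cyclotomic fields in characteristic p *)

Section CyclotomicPlace.
Variables (p k : nat) (L : fieldType) (g : L).
Hypotheses (p_pr : prime p) (charL : p \in [pchar L]) (prim_g : k.-primitive_root g).

Local Notation evalL P := (map_poly intr P).[g].

Let k_gt0 : (0 < k)%N. Proof. exact: prim_order_gt0 prim_g. Qed.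
Let p_gt0 : (0 < p)%N. Proof. exact: prime_gt0. Qed.
Let pk_gt0 : (0 < p * k)%N. Proof. by rewrite muln_gt0 p_gt0. Qed.

(* Dividing the factorizations of X^(pk) - 1 and X^k - 1 shows that the
   product of the Phi_d with d | pk and not d | k is the sum of the X^(ki) for
   i < p; it vanishes at g, and g is a root of Phi_d only if k | d. *)
Lemma Cyclotomic_root_mod_p : evalL 'Phi_(p * k) = 0.
Proof.
pose G := \prod_(d <- divisors (p * k) | ~~ (d %| k)%N) 'Phi_d.
have defG : G = \sum_(i < p) ('X^k) ^+ i.
  apply: (@mulfI _ ('X^k - 1 : {poly int})).
    by rewrite -size_poly_eq0 size_XnsubC.
  rewrite -subrX1 -exprM mulnC -prod_Cyclotomic // -prod_Cyclotomic //.
  rewrite [RHS](bigID (fun d => d %| k)%N) /= -/G; congr (_ * _).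
  rewrite -[RHS]big_filter; apply: perm_big; apply: uniq_perm.
  - exact: divisors_uniq.
  - by rewrite filter_uniq ?divisors_uniq.
  move=> d; rewrite mem_filter -!dvdn_divisors //.
  by apply/idP/andP=> [dk|[]//]; split=> //; apply: dvdn_mull.
have: evalL G = 0.
  rewrite defG rmorph_sum /= horner_sum (eq_bigr (fun _ => 1)) => [|i _].
    by rewrite sumr_const card_ord (pcharf0 charL).
  by rewrite -exprM map_polyXn hornerXn exprM (prim_expr_order prim_g) expr1n.
rewrite /G rmorph_prod /= horner_prod => /eqP; rewrite prodf_seq_eq0 => /hasP[d].
rewrite -dvdn_divisors // => d_pk /andP[ndk /eqP Phi_d0].
have d_gt0 : (0 < d)%N by apply: dvdn_gt0 d_pk.
have gd1 : g ^+ d = 1.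
  have: evalL ('X^d - 1 : {poly int}) = 0.
    rewrite -prod_Cyclotomic // rmorph_prod /= horner_prod.
    apply/eqP; rewrite prodf_seq_eq0; apply/hasP; exists d; last by rewrite Phi_d0 /=.
    by rewrite -dvdn_divisors.
  rewrite rmorphB rmorph1 /= map_polyXn !hornerE /= => /eqP.
  by rewrite subr_eq0 => /eqP.
have /dvdnP[c Ed] : (k %| d)%N by rewrite (prim_order_dvd prim_g) gd1.
move: d_pk; rewrite Ed dvdn_pmul2r // => /(primeP p_pr).2 /orP[]/eqP Ec.
  by rewrite Ed Ec mul1n dvdnn in ndk.
by rewrite -Phi_d0 Ed Ec.
Qed.

(** ['Phi_(p * k)] is monic and is the minimal polynomial of [z], so it divides every integer
    polynomial vanishing at [z]. As it also vanishes at [g], sending [z] to [g] is well defined on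
    Z[z]. *)
Lemma Cyclotomic_eval0 (z : algC) (P : {poly int}) :
  (p * k).-primitive_root z -> (map_poly intr P).[z] = 0 -> evalL P = 0.
Proof.
move=> prim_z Pz0; pose F := 'Phi_(p * k).
have F_mon : F \is monic by apply: Cyclotomic_monic.
have EP := Pdiv.RingMonic.rdivp_eq F_mon P.
have Fz : (map_poly intr F).[z] = 0 :> algC.
  by apply/rootP; rewrite /F (Cintr_Cyclotomic prim_z) root_cyclotomic.
set q := Pdiv.Ring.rdivp P F in EP; set r := Pdiv.Ring.rmodp P F in EP.
suff r0 : r = 0.
  by rewrite EP r0 addr0 rmorphM hornerM Cyclotomic_root_mod_p mulr0.
have rz : (map_poly intr r).[z] = 0 :> algC.
  by move: Pz0; rewrite EP rmorphD rmorphM /= hornerD hornerM Fz mulr0 add0r.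
(* The remainder [r] vanishes at [z] but has smaller degree than the minimal polynomial. *)
have [m [Dm m_mon] dvd_m] := minCpolyP z.
have size_m : size m = size F.
  rewrite -(size_map_poly (ratr : {rmorphism rat -> algC})) -Dm (minCpoly_cyclotomic prim_z).
  by rewrite size_cyclotomic size_Cyclotomic.
apply/eqP; apply: contraTT isT => r_neq0.
have: root (map_poly ratr (map_poly (intr : int -> rat) r)) z.
  rewrite -map_poly_comp; apply/rootP; rewrite -[RHS]rz; congr (_ .[_]).
  by apply: eq_map_poly => x /=; rewrite ratr_int.
rewrite dvd_m => /dvdp_leq; rewrite map_poly_eq0_id0 => [|]; last first.
  by rewrite intr_eq0 lead_coef_eq0.
move/(_ r_neq0); rewrite size_m size_map_inj_poly //; last exact: intr_inj.
by rewrite leqNgt Pdiv.Ring.ltn_rmodpN0 // monic_neq0.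
Qed.

(* The localization of Z[z] at the kernel of z |-> g. *)
Lemma cyclotomic_place : exists (R : place algC L) (z : algC),
  (p * k).-primitive_root z /\ R z g.
Proof.
have [z prim_z] := C_prim_root_exists pk_gt0.
pose evalC (P : {poly int}) : algC := (map_poly intr P).[z].
have ker P : evalL P != 0 -> evalC P != 0.
  by apply: contra => /eqP Pz; apply/eqP; apply: Cyclotomic_eval0 prim_z Pz.
pose R x u := exists P Q : {poly int},
  [/\ evalL Q != 0, x = evalC P / evalC Q & u = evalL P / evalL Q].
have Rfun x u v : R x u -> R x v -> u = v.
  case=> P [Q [Q0 Ex ->]] [P' [Q' [Q'0 Ex' ->]]].
  have Q0z := ker _ Q0; have Q'0z := ker _ Q'0.
  apply/eqP; rewrite eqr_div // -subr_eq0; apply/eqP.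
  have:= @Cyclotomic_eval0 z (P * Q' - P' * Q) prim_z.
  rewrite !rmorphB !rmorphM /= !hornerE; apply.
  by apply/eqP; rewrite subr_eq0 -eqr_div // -/(evalC _) -Ex Ex'.
have R1 : R 1 1.
  exists 1, 1; rewrite /evalC !rmorph1 !hornerE; split; rewrite ?oner_eq0 ?invr1 ?mulr1 //.
have RB x y u v : R x u -> R y v -> R (x - y) (u - v).
  case=> P [Q [Q0 -> ->]] [P' [Q' [Q'0 -> ->]]].
  exists (P * Q' - P' * Q), (Q * Q'); rewrite /evalC !rmorphB !rmorphM /= !hornerE.
  rewrite mulf_neq0 //; split=> //; rewrite -mulNr addf_div ?mulNr //; exact: ker.
have RM x y u v : R x u -> R y v -> R (x * y) (u * v).
  case=> P [Q [Q0 -> ->]] [P' [Q' [Q'0 -> ->]]].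
  exists (P * P'), (Q * Q'); rewrite /evalC !rmorphM /= !hornerM.
  by rewrite mulf_neq0 // !mulf_div.
have RV x u : R x u -> u != 0 -> R x^-1 u^-1.
  case=> P [Q [Q0 -> ->]] u0; exists Q, P; rewrite !invf_div; split=> //.
  by apply: contraNneq u0 => ->; rewrite mul0r.
exists (Place Rfun R1 RB RM RV), z; split=> //; exists 'X, 1.
by rewrite /evalC !rmorph1 !map_polyX !hornerE; split; rewrite ?oner_eq0 ?invr1 ?mulr1.
Qed.

End CyclotomicPlace.

(** * Finite fields and Teichmuller lifts *)

Section FiniteField.
Variables (p f : nat) (L : finFieldType).
Hypotheses (p_pr : prime p) (cardL : #|L| = (p ^ f)%N).

Lemma finField_prim_root : exists g : L, (#|L|.-1).-primitive_root g.
Proof.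
have L_gt1 := card_finRing_gt1 L.
pose rs := rem 0 (enum L).
have rs0 x : (x \in rs) = (x != 0).
  by rewrite mem_rem_uniq ?enum_uniq // !inE mem_enum andbT.
have: has (#|L|.-1).-primitive_root rs.
  apply: has_prim_root; first by rewrite -subn1 subn_gt0.
  - apply/allP=> x; rewrite rs0 => x0; rewrite unity_rootE; apply/eqP.
    by apply: (mulfI x0); rewrite mulr1 -exprS prednK ?(ltnW L_gt1) // expf_card.
  - by rewrite rem_uniq ?enum_uniq.
  by rewrite size_rem ?mem_enum // cardE.
by case/hasP=> g _ g_prim; exists g.
Qed.

Lemma expf_card_pred (x : L) : x != 0 -> x ^+ #|L|.-1 = 1.
Proof.
move=> x0; apply: (mulfI x0); rewrite mulr1 -exprS prednK ?expf_card //.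
exact: ltnW (card_finRing_gt1 L).
Qed.

Lemma pchar_finField : p \in [pchar L]. Proof. exact: card_finPcharP cardL p_pr. Qed.

Lemma frobD i (x y : L) : (x + y) ^+ (p ^ i) = x ^+ (p ^ i) + y ^+ (p ^ i).
Proof.
apply: exprDn_pchar; apply/pnatP; first by rewrite expn_gt0 prime_gt0.
by move=> r r_pr; rewrite Euclid_dvdX // => /andP[]; rewrite dvdn_prime2 // => /eqP-> _; apply: pchar_finField.
Qed.

Lemma frob0 i : 0 ^+ (p ^ i) = 0 :> L.
Proof. by rewrite expr0n expn_eq0 eqn0Ngt prime_gt0. Qed.

Lemma frob_sum i (I : finType) (P : pred I) (F : I -> L) :
  (\sum_(j | P j) F j) ^+ (p ^ i) = \sum_(j | P j) F j ^+ (p ^ i).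
Proof.
apply: (big_morph (fun x : L => x ^+ (p ^ i)) (id1 := 0)).
  exact: frobD.
exact: frob0.
Qed.

Lemma frob_inj i : injective (fun x : L => x ^+ (p ^ i)).
Proof.
move=> x y /= Exy; apply/eqP; rewrite -subr_eq0; apply/eqP.
have: (x - y) ^+ (p ^ i) = 0.
  apply: (addIr (y ^+ (p ^ i))); rewrite -frobD subrK add0r; exact: Exy.
by move/eqP; rewrite expf_eq0 => /andP[_ /eqP].
Qed.

(* A nonzero polynomial of degree p^d has at most p^d roots. *)
Lemma sum_frob_neq0 (V : {set L}) d : (p ^ d < #|V|)%N ->
  exists2 y, y \in V & \sum_(a < d.+1) y ^+ (p ^ a) != 0.
Proof.
move=> ltV; apply/exists_inP; apply: contraLR ltV => /exists_inPn H.
rewrite -leqNgt; pose P : {poly L} := \sum_(a < d.+1) 'X^(p ^ a).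
have szP : size P = (p ^ d).+1.
  rewrite /P big_ord_recr /= addrC size_polyDl ?size_polyXn //.
  apply: leq_ltn_trans (size_sum _ _ _) _; rewrite ltnS; apply/bigmax_leqP=> a _.
  by rewrite size_polyXn ltn_exp2l ?prime_gt1.
rewrite -ltnS -szP cardE; apply: max_poly_roots; last exact: enum_uniq.
  by rewrite -size_poly_eq0 szP.
apply/allP=> y; rewrite mem_enum => /H; rewrite negbK => /eqP Hy.
rewrite rootE /P horner_sum -[X in _ == X]Hy; apply/eqP.
by apply: eq_bigr => a _; rewrite hornerXn.
Qed.

Lemma natr_eq_mod a b : ((a%:R : L) == b%:R) = (a == b %[mod p])%N.
Proof.
wlog le_ba : a b / (b <= a)%N.
  by case: (leqP b a) => [|/ltnW] H IH; [|rewrite eq_sym [RHS]eq_sym]; apply: IH.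
by rewrite -subr_eq0 -natrB // -(dvdn_pcharf pchar_finField) eqn_mod_dvd.
Qed.

(** The [p] elements of the prime field are already roots of X^p - X; a fixed point outside it would
    be one root too many. *)
Lemma frob_fixed (x : L) : x ^+ p = x -> exists k : 'I_p, k%:R == x.
Proof.
move=> xp; apply/existsP; apply: contraT => /existsPn H.
pose rs := x :: [seq (k : 'I_p)%:R : L | k <- enum 'I_p].
pose P : {poly L} := 'X^p - 'X.
have szP : size P = p.+1.
  by rewrite size_polyDl ?size_polyXn // size_polyN size_polyX ltnS prime_gt1.
have: (size rs < size P)%N.
  apply: max_poly_roots.
  - by rewrite -size_poly_eq0 szP.
  - rewrite /= rootE !hornerE xp subrr eqxx /=; apply/allP=> _ /mapP[k _ ->].
    by rewrite rootE !hornerE -(pFrobenius_autE pchar_finField) rmorph_nat subrr.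
  rewrite /= map_inj_uniq ?enum_uniq ?andbT => [|k k' /eqP].
    by apply/mapP=> -[k _ E]; have:= H k; rewrite E eqxx.
  by rewrite natr_eq_mod !modn_small // => /eqP/val_inj.
by rewrite /= size_map size_enum_ord szP ltnn.
Qed.

(** The absolute trace from [L] to its prime field, for [#|L| = p ^ f]. *)
Definition abstr (x : L) : L := \sum_(i < f) x ^+ (p ^ i).

Lemma abstrD x y : abstr (x + y) = abstr x + abstr y.
Proof. by rewrite -big_split; apply: eq_bigr => i _; rewrite frobD. Qed.

(** Frobenius shifts the summands cyclically, since [x ^+ (p ^ f) = x]. *)
Lemma abstr_frob x : abstr (x ^+ p) = abstr x.
Proof.
have f_gt0 : (0 < f)%N.
  by rewrite lt0n; apply/eqP=> f0; have := card_finRing_gt1 L; rewrite cardL f0.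
rewrite /abstr; case: f f_gt0 cardL => // d _ cL.
rewrite big_ord_recr big_ord_recl /= -exprM -expnS -cL expf_card addrC expn0 expr1.
by congr (_ + _); apply: eq_bigr => i _; rewrite -exprM -expnS.
Qed.

Lemma abstr_fixed x : abstr x ^+ p = abstr x.
Proof.
rewrite -[in RHS]abstr_frob /abstr -{2}[p]expn1 frob_sum; apply: eq_bigr => i _.
by rewrite -!exprM mulnC expn1.
Qed.

Lemma abstr_nat x : exists k : 'I_p, k%:R == abstr x.
Proof. exact/frob_fixed/abstr_fixed. Qed.

End FiniteField.

Lemma sum_neq0_scale (L : finFieldType) (V : nmodType) (c : L) (F : L -> V) :
  c != 0 -> \sum_(x | x != 0) F (x * c) = \sum_(x | x != 0) F x.
Proof.
move=> c0; rewrite [RHS](reindex_inj (mulIf c0)) /=; apply: eq_bigl => x.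
by rewrite mulf_eq0 (negPf c0) orbF.
Qed.

Section Teichmuller.
Variables (K : fieldType) (L : finFieldType) (R : place K L) (T : L -> K).
Hypotheses (TM : {morph T : x y / x * y}) (redT : forall x, R (T x) x).

Lemma Teich_inj : injective T.
Proof. by move=> x y Exy; apply: (red_fun (redT x)); rewrite Exy. Qed.

Lemma Teich_neq0 x : x != 0 -> T x != 0.
Proof. exact: red_neq0 (redT x). Qed.

Lemma Teich1 : T 1 = 1.
Proof.
have T10 : T 1 != 0 by rewrite Teich_neq0 ?oner_eq0.
by apply: (mulfI T10); rewrite mulr1 -TM mulr1.
Qed.

Lemma Teich0 : T 0 = 0.
Proof.
apply/eqP; apply: contraT => T00; have := oner_neq0 L.
suff ->: 1 = 0 :> L by rewrite eqxx.
apply: Teich_inj; rewrite Teich1; apply: (mulfI T00); by rewrite mulr1 -TM mulr0.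
Qed.

Lemma TeichX x n : T (x ^+ n) = T x ^+ n.
Proof. by elim: n => [|n IH]; rewrite ?expr0 ?Teich1 // !exprS TM IH. Qed.

Lemma Teich_prod (I : finType) (F : I -> L) : T (\prod_i F i) = \prod_i T (F i).
Proof. by apply: big_morph; [apply: TM | apply: Teich1]. Qed.

Lemma Teich_eq1 x : (T x == 1) = (x == 1).
Proof. by rewrite -Teich1 (inj_eq Teich_inj). Qed.

Lemma natr_pred_card : (#|L|.-1)%:R = -1 :> L.
Proof.
have L_gt0 : (0 < #|L|)%N by apply: ltnW (card_finRing_gt1 L).
apply/eqP; rewrite -addr_eq0 natr1 prednK // -sumr_const.
(* Translation by 1 permutes [L], so adding 1 to each term leaves the sum of all elements unchanged;
   hence [#|L|] is 0 in [L]. *)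
apply/eqP; apply: (addrI (\sum_x x)); rewrite addr0 -big_split /=.
by rewrite [RHS](reindex_inj (addIr 1)).
Qed.

Lemma pred_card_neq0 : (#|L|.-1)%:R != 0 :> K.
Proof. by apply: red_neq0 (red_nat R _) _; rewrite natr_pred_card oppr_eq0 oner_eq0. Qed.

(** If [#|L|.-1] divides [a], every term is 1. Otherwise, for a generator [g], replacing [x] by
    [x * g] multiplies the sum by [T (g ^+ a)], which is not 1. *)
Lemma Teich_power_sum a : \sum_(x | x != 0) T x ^+ a =
  if (#|L|.-1 %| a)%N then (#|L|.-1)%:R else 0.
Proof.
case: ifPn => [/dvdnP[c ->]|ndvd].
  rewrite (eq_bigr (fun _ => 1)) => [|x x0].
    rewrite sumr_const; congr _%:R.
    by rewrite -(cardC1 (0 : L)); apply: eq_card => x; rewrite !inE.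
  by rewrite -TeichX mulnC exprM expf_card_pred // expr1n Teich1.
have [g g_prim] := finField_prim_root L.
have g0 : g != 0.
  apply: contraNneq ndvd => g0; have := prim_expr_order g_prim; rewrite g0 expr0n.
  case: (#|L|.-1 =P 0)%N => [E _|_ /eqP]; last by rewrite eq_sym oner_eq0.
  by have := card_finRing_gt1 L; rewrite -subn_gt0 subn1 E.
have ga_neq1 : T (g ^+ a) - 1 != 0.
  by rewrite subr_eq0 Teich_eq1 -(prim_order_dvd g_prim).
apply: (mulfI ga_neq1); apply/eqP; rewrite mulr0 mulrBl mul1r subr_eq0 mulr_sumr; apply/eqP.
rewrite -[RHS](sum_neq0_scale _ g0); apply: eq_bigr => x _.
by rewrite TeichX TM exprMn mulrC.
Qed.

Lemma power_sum a : \sum_(x : L | x != 0) x ^+ a =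
  if (#|L|.-1 %| a)%N then -1 else 0.
Proof.
apply: (@red_fun _ _ R (\sum_(x | x != 0) T x ^+ a)).
  by apply: red_sum => x _; apply: redX.
rewrite Teich_power_sum; case: ifP => _; last exact: red0.
by rewrite -natr_pred_card; apply: red_nat.
Qed.

End Teichmuller.

(** * Gauss sums *)

Section GaussSums.
Variables (p f : nat) (K : fieldType) (L : finFieldType) (R : place K L).
Variables (T : L -> K) (eps : K).
Hypotheses (p_pr : prime p) (cardL : #|L| = (p ^ f)%N).
Hypotheses (TM : {morph T : x y / x * y}) (redT : forall x, R (T x) x).
Hypotheses (eps_p : eps ^+ p = 1) (eps_neq1 : eps != 1) (red_eps : R eps 1).

Local Notation tr := (abstr p f).
Local Notation Q1 := (#|L|.-1).
Local Notation pi := (eps - 1).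

Let L_gt1 : (1 < #|L|)%N. Proof. exact: card_finRing_gt1. Qed.
Let Q1_gt0 : (0 < Q1)%N. Proof. by rewrite -subn1 subn_gt0. Qed.
Let card_L : #|L| = Q1.+1. Proof. by rewrite prednK // ltnW. Qed.
Let f_gt0 : (0 < f)%N.
Proof. by rewrite lt0n; apply/eqP=> f0; move: L_gt1; rewrite cardL f0. Qed.

Lemma pi_neq0 : pi != 0. Proof. by rewrite subr_eq0. Qed.

Lemma red_pi : R pi 0.
Proof. by rewrite -(subrr 1); apply: redB => //; apply: red1. Qed.

(** Expanding (1 + pi)^p = 1 and cancelling one factor pi gives pi^(p-1) = -pB, where [B] has
    integer coefficients in pi and constant term 1, hence reduces to 1. *)
Lemma p_pi_expE : exists2 eta, p%:R = pi ^+ (p - 1) * eta & R eta (-1).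
Proof.
pose B := \sum_(i < p.-1) ('C(p, i.+1) %/ p)%:R * pi ^+ i.
have p0 := prime_gt0 p_pr.
have EB : pi ^+ p.-1 = - (p%:R * B).
  apply: (mulIf pi_neq0); apply/eqP; rewrite -subr_eq0 mulNr opprK.
  move: eps_p; rewrite -{1}(subrKC 1 eps) exprDn -(prednK p0).
  rewrite big_ord_recl big_ord_recr /= expr0 binn bin0 !expr1n !mulr1n mul1r.
  rewrite -[X in _ = X -> _]addr0 => /addrI E; apply/eqP.
  rewrite -[RHS]E mul1r /bump /= add1n -exprSr addrC; congr (_ + _).
  rewrite /B mulr_sumr mulr_suml; apply: eq_bigr => i _.
  have /dvdnP[c Ec] : (p %| 'C(p, i.+1))%N.
    by apply: prime_dvd_bin => //=; rewrite -ltn_predRL ltn_ord.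
  rewrite (prednK p0) add1n expr1n mul1r Ec mulnK // -[RHS]mulr_natl natrM exprSr; ring.
have RB : R B 1.
  rewrite /B; have: (0 < p.-1)%N by rewrite -subn1 subn_gt0 prime_gt1.
  case: p.-1 => // d _; rewrite big_ord_recl bin1 divnn p0 mul1r expr0.
  rewrite -[X in R _ X]addr0; apply: redD; first exact: red1.
  have -> : 0 = \sum_(i < d) (0 : L) by rewrite big1.
  apply: red_sum => i _; rewrite -[X in R _ X](mulr0 (('C(p, (lift ord0 i).+1) %/ p)%:R : L)).
  apply: redM; first exact: red_nat.
  by rewrite exprS -[X in R _ X](mul0r (0 ^+ i)); apply: redM; [exact: red_pi | apply/redX/red_pi].
have B0 : B != 0 by apply: red_neq0 RB (oner_neq0 _).
exists (- B^-1); first by rewrite subn1 EB mulrNN mulfK.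
by apply: redN; rewrite -invr1; apply: redV => //; apply: oner_neq0.
Qed.

(** The trace lies in the prime field, so [pick] always finds an integer representing it; the
    default exponent 0 never occurs. *)
Definition addchar (x : L) : K :=
  eps ^+ oapp (@nat_of_ord p) 0%N [pick k : 'I_p | k%:R == tr x].
Local Notation Psi := addchar.

Lemma addcharE k x : k%:R = tr x -> Psi x = eps ^+ k.
Proof.
rewrite /addchar => Ek; case: pickP => [k' /eqP/=|H]; last first.
  by have [k' Ek'] := abstr_nat p_pr cardL x; rewrite H in Ek'.
rewrite -Ek => /eqP; rewrite (natr_eq_mod p_pr cardL) => /eqP E.
by rewrite -(expr_mod k' eps_p) E expr_mod.
Qed.

Lemma addcharP x : exists2 k : nat, k%:R = tr x & Psi x = eps ^+ k.
Proof.
have [k /eqP Ek] := abstr_nat p_pr cardL x.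
by exists k => //; apply: addcharE.
Qed.

Lemma addcharD x y : Psi (x + y) = Psi x * Psi y.
Proof.
have [k Ek ->] := addcharP x; have [j Ej ->] := addcharP y.
by rewrite -exprD; apply: addcharE; rewrite (abstrD p_pr cardL) natrD Ek Ej.
Qed.

Lemma addchar_frob x : Psi (x ^+ p) = Psi x.
Proof. by rewrite /addchar (abstr_frob cardL). Qed.

(** [w] is the geometric sum (eps^k - 1)/pi, each of whose [k] terms reduces to 1. *)
Lemma addchar_red x : exists2 w, Psi x = 1 + pi * w & R w (tr x).
Proof.
have [k <- ->] := addcharP x; exists (\sum_(i < k) eps ^+ i).
  by rewrite -subrX1 addrC subrK.
rewrite -[k in k%:R]card_ord -sumr_const; apply: red_sum => i _.
by rewrite -(expr1n _ i); apply: redX.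
Qed.

Lemma addchar_eq1 x : (Psi x == 1) = (tr x == 0).
Proof.
apply/eqP/eqP=> [|tr0]; last by rewrite (@addcharE 0) // tr0.
have [w -> Rw] := addchar_red x; rewrite -[X in _ = X]addr0 => /addrI/eqP.
rewrite mulf_eq0 (negPf pi_neq0) /= => /eqP w0; apply: (@red_eq0 _ _ R).
by rewrite -w0.
Qed.

Lemma addchar0 : Psi 0 = 1.
Proof.
apply/eqP; rewrite addchar_eq1 /abstr big1 // => i _.
exact: frob0.
Qed.

(** Translation by [y0] multiplies the sum by [Psi (y0 * z)], which is not 1. A general [V] lets
    this serve both for [L] and for its subfield of order q. *)
Lemma addchar_sum0 (V : {set L}) y0 z :
  (forall y, (y + y0 \in V) = (y \in V)) -> tr (y0 * z) != 0 ->
  \sum_(y in V) Psi (y * z) = 0.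
Proof.
move=> VD tr0; have: Psi (y0 * z) - 1 != 0 by rewrite subr_eq0 addchar_eq1.
move=> Psi1; apply: (mulfI Psi1); rewrite mulr0 mulrBl mul1r.
apply/eqP; rewrite subr_eq0; apply/eqP.
rewrite [RHS](reindex_inj (addIr y0)) mulr_sumr; apply: eq_big => y; first by rewrite VD.
by rewrite mulrDl addcharD mulrC.
Qed.

Lemma addchar_sum : \sum_x Psi x = 0.
Proof.
have lt : (p ^ f.-1 < #|[set: L]|)%N.
  by rewrite cardsT cardL ltn_exp2l ?prime_gt1 // prednK.
have [y0 _ y0_tr] := sum_frob_neq0 p_pr lt.
rewrite -[RHS](@addchar_sum0 setT y0 1) ?mulr1.
- by apply: eq_big => x; rewrite ?inE ?mulr1.
- by move=> y; rewrite !inE.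
by rewrite /abstr; rewrite (prednK f_gt0) in y0_tr.
Qed.

Lemma addchar_sum_neq0 : \sum_(x | x != 0) Psi x = -1.
Proof.
apply: (addrI (Psi 0)); rewrite addchar0 subrr -[RHS]addchar_sum.
by rewrite [RHS](bigD1 0) //= addchar0.
Qed.

(** The Gauss sum of the character T^(-a); with the inverse, its valuation is the digit sum of [a]
    and not that of [Q1 - a]. *)
Definition gauss a := \sum_(x | x != 0) T x^-1 ^+ a * Psi x.

Lemma gauss0 : gauss 0 = -1.
Proof.
by rewrite -addchar_sum_neq0; apply: eq_bigr => x _; rewrite expr0 mul1r.
Qed.

Lemma inv_power_sum a : \sum_(x | x != 0) T x^-1 ^+ a = if (Q1 %| a)%N then Q1%:R else 0.
Proof.
rewrite -(Teich_power_sum TM redT) [LHS](reindex_inj invr_inj) /=.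
by apply: eq_big => x; rewrite ?invr_eq0 // invrK.
Qed.

Lemma gauss_frob a : gauss (p * a) = gauss a.
Proof.
rewrite /gauss [RHS](reindex_inj (@frob_inj _ f L p_pr cardL 1)) /=.
apply: eq_big => x; first by rewrite expf_eq0 expn1 prime_gt0.
by rewrite expn1 addchar_frob -exprVn (TeichX TM redT) exprM.
Qed.

Lemma gauss_twist n c : c != 0 ->
  \sum_(x | x != 0) T x^-1 ^+ n * Psi (x * c) = T c ^+ n * gauss n.
Proof.
move=> c0; rewrite /gauss mulr_sumr -[RHS](sum_neq0_scale _ c0).
apply: eq_bigr => x x0; rewrite mulrA -exprMn -TM; congr (T _ ^+ _ * _).
by rewrite invfM mulrCA divff // mulr1.
Qed.

(** The Jacobi sum in the coordinate u = y/x, used with [n] the sum of the two exponents. *)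
Definition jacobi b n :=
  \sum_(u | (u != 0) && (u != -1)) T u^-1 ^+ b * T (1 + u) ^+ n.

Lemma gauss_mul a b :
  gauss a * gauss b =
  T (-1) ^+ b * (if (Q1 %| a + b)%N then Q1%:R else 0) + jacobi b (a + b) * gauss (a + b).
Proof.
have ->: gauss a * gauss b = \sum_(u | u != 0)
    T u^-1 ^+ b * \sum_(x | x != 0) T x^-1 ^+ (a + b) * Psi (x * (1 + u)).
  rewrite /gauss big_distrlr /=.
  under eq_bigr => x x0 do rewrite -(sum_neq0_scale _ x0).
  rewrite exchange_big /=; apply: eq_bigr => u _; rewrite mulr_sumr.
  apply: eq_bigr => x _.
  rewrite invfM TM mulrDr mulr1 addcharD [x * u]mulrC exprMn exprD; ring.
rewrite (bigD1 (-1)) /=; last by rewrite oppr_eq0 oner_eq0.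
congr (_ + _).
  rewrite invrN invr1 -inv_power_sum; congr (_ * _); apply: eq_bigr => x _.
  by rewrite subrr mulr0 addchar0 mulr1.
rewrite /jacobi mulr_suml; apply: eq_bigr => u /andP[u0 u1].
by rewrite gauss_twist ?mulrA // addrC addr_eq0.
Qed.

Lemma gauss_compl a : (0 < a < Q1)%N ->
  gauss a * gauss (Q1 - a) = T (-1) ^+ (Q1 - a) * #|L|%:R.
Proof.
case/andP=> a0 aQ; rewrite gauss_mul subnKC ?(ltnW aQ) // dvdnn.
have ->: gauss Q1 = -1.
  rewrite -addchar_sum_neq0; apply: eq_bigr => x x0.
  by rewrite -(TeichX TM redT) expf_card_pred ?invr_eq0 // (Teich1 TM redT) mul1r.
suff ->: jacobi (Q1 - a) Q1 = - T (-1) ^+ (Q1 - a).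
  (* With [T (1 + u) ^+ Q1 = 1], the Jacobi sum is a complete power sum, which vanishes, without its
     term at [u = -1]. *)
  by rewrite mulrNN mulr1 -{2}[T (-1) ^+ _]mulr1 -mulrDr natr1 -card_L.
apply: (addrI (T (-1) ^+ (Q1 - a))); rewrite subrr.
rewrite -[RHS](_ : \sum_(x | x != 0) T x^-1 ^+ (Q1 - a) = 0); last first.
  by rewrite inv_power_sum gtnNdvd // ?subn_gt0 // ltn_subrL a0.
rewrite [RHS](bigD1 (-1)) ?oppr_eq0 ?oner_eq0 //= invrN invr1; congr (_ + _).
apply: eq_bigr => u /andP[_ u1]; rewrite -[T (1 + u) ^+ _](TeichX TM redT) expf_card_pred.
  by rewrite (Teich1 TM redT) mulr1.
by rewrite addrC addr_eq0.
Qed.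

Lemma red_jacobi b n : exists u, R (jacobi b n) u.
Proof.
exists (\sum_(u | (u != 0) && (u != -1)) u^-1 ^+ b * (1 + u) ^+ n).
by apply: red_sum => u _; apply: redM; apply: redX.
Qed.

(* Modulo pi^2, gauss 1 is pi times the sum of T(x)^-1 Tr(x). *)
Lemma gauss1_val : (1 < Q1)%N -> exists2 w, gauss 1 = pi * w & R w (-1).
Proof.
move=> Q1_gt1; pose w x := (Psi x - 1) / pi.
have Ew x : Psi x = 1 + pi * w x by rewrite mulrC divfK ?pi_neq0 // addrC subrK.
have Rw x : R (w x) (tr x).
  have [v Ev Rv] := addchar_red x.
  by rewrite /w Ev addrAC subrr add0r mulrC mulKf ?pi_neq0.
exists (\sum_(x | x != 0) T x^-1 * w x).
  transitivity (\sum_(x | x != 0) (T x^-1 ^+ 1 + pi * (T x^-1 * w x))).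
    by apply: eq_bigr => x _; rewrite Ew expr1; ring.
  by rewrite big_split /= inv_power_sum gtnNdvd // add0r mulr_sumr.
(* The trace contributes the exponents [(p ^ i).-1], all below [Q1]; only [i = 0] gives a multiple
   of [Q1]. *)
have <-: \sum_(x : L | x != 0) x^-1 * tr x = -1.
  transitivity (\sum_(i < f) \sum_(x : L | x != 0) x ^+ (p ^ i).-1).
    rewrite exchange_big /=; apply: eq_bigr => x x0.
    rewrite mulr_sumr; apply: eq_bigr => i _.
    by apply: (mulfI x0); rewrite mulVKf // -exprS prednK // expn_gt0 prime_gt0.
  rewrite (bigD1 (Ordinal f_gt0)) //= (power_sum TM redT) dvdn0.
  rewrite big1 ?addr0 // => i i0; rewrite (power_sum TM redT) gtnNdvd //.
    rewrite -subn1 subn_gt0 -{1}(expn0 p) ltn_exp2l ?prime_gt1 // lt0n.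
    by apply: contraNneq i0 => i0; apply/eqP/val_inj.
  rewrite -ltnS -card_L prednK ?expn_gt0 ?prime_gt0 // cardL.
  by rewrite ltn_exp2l ?prime_gt1.
by apply: red_sum => x _; apply: redM.
Qed.

(** One inequality: the valuation of [gauss a] is at most the digit sum. If [p] divides [a], pass to
    the quotient; otherwise lower [a] by 1 at the cost of a factor [gauss 1], which is pi times a
    unit. *)
Lemma gauss_dvd a : (0 < a < Q1)%N ->
  exists w u, R w u /\ gauss a * w = pi ^+ digsum p a.
Proof.
have p1 := prime_gt1 p_pr.
elim/ltn_ind: a => a IH /andP[a0 aQ].
have [/dvdnP[c Ec]|ndvd] := boolP (p %| a)%N.
  have c0 : (0 < c)%N by move: a0; rewrite Ec muln_gt0 => /andP[].
  have ca : (c < a)%N by rewrite Ec -{1}(muln1 c) ltn_pmul2l.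
  have [w [u [Rw Ew]]] := IH c ca (introT andP (conj c0 (ltn_trans ca aQ))).
  by exists w, u; rewrite Ec mulnC gauss_frob digsumMp.
have [v Ev Rv] := gauss1_val (leq_ltn_trans a0 aQ).
have v0 : v != 0 by apply: red_neq0 Rv _; rewrite oppr_eq0 oner_eq0.
have Rv1 : R v^-1 (-1)^-1 by apply: redV => //; rewrite oppr_eq0 oner_eq0.
case: a a0 aQ ndvd IH => // -[|a] _ aQ ndvd IH.
  exists v^-1, (-1)^-1; split=> //; rewrite digsumS // digsum0 expr1 Ev mulfK //.
have [w [u [Rw Ew]]] := IH a.+1 (ltnSn _) (ltnW aQ).
have [j Rj] := red_jacobi a.+1 a.+2.
exists (jacobi a.+1 a.+2 * (v^-1 * w)), (j * ((-1)^-1 * u)).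
split; first by do 2!apply: redM => //.
(* The exponent [a.+2] is below [Q1], so the product formula has no exceptional term. *)
have := gauss_mul 1 a.+1; rewrite add1n gtnNdvd // mulr0 add0r => E.
rewrite digsumS // exprS -Ew.
have ->: gauss a.+2 * (jacobi a.+1 a.+2 * (v^-1 * w)) = gauss 1 * gauss a.+1 * (v^-1 * w).
  by rewrite E; ring.
by rewrite Ev; field.
Qed.

(** The inequalities for [a] and [Q1 - a] add up to the exact valuation of the product
    [gauss a * gauss (Q1 - a)], so both are equalities. *)
Lemma gauss_val a : (0 < a < Q1)%N ->
  exists w u, [/\ R w u, u != 0 & gauss a = pi ^+ digsum p a * w].
Proof.
move=> /[dup] aQ /andP[a0 ltaQ].
have bQ : (0 < Q1 - a < Q1)%N by rewrite subn_gt0 ltaQ ltn_subrL a0.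
have [w [u [Rw Ew]]] := gauss_dvd aQ; have [w' [u' [Rw' Ew']]] := gauss_dvd bQ.
have [eta Eeta Reta] := p_pi_expE.
have Edig : (digsum p a + digsum p (Q1 - a) = (p - 1) * f)%N.
  rewrite mulnC; apply: digsum_compl; first exact: prime_gt1.
  by rewrite subnKC ?(ltnW ltaQ) // -card_L.
pose c := T (-1) ^+ (Q1 - a) * eta ^+ f; pose d : L := (-1) ^+ (Q1 - a) * (-1) ^+ f.
have EQ : #|L|%:R = pi ^+ (digsum p a + digsum p (Q1 - a)) * eta ^+ f.
  by rewrite Edig exprM -exprMn -Eeta -natrX -cardL.
have Rc : R c d by apply: redM; apply: redX.
(* The cofactor [w] is thus a unit of the local ring, with inverse [w' * c]. *)
have E : w * (w' * c) = 1.
  have pi0 : pi ^+ (digsum p a + digsum p (Q1 - a)) != 0 by rewrite expf_neq0 ?pi_neq0.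
  apply: (mulfI pi0); rewrite mulr1 [RHS]exprD -Ew -Ew' mulrACA gauss_compl //.
  by rewrite EQ /c; ring.
have uE : u * (u' * d) = 1.
  apply: (red_fun (redM Rw (redM Rw' Rc))); rewrite E; exact: red1.
have Ru : R (w' * c) (u' * d) by apply: redM => //; apply: redM.
exists (w' * c), (u' * d); split=> //.
  by apply: contra_eq_neq uE => ->; rewrite mulr0 eq_sym oner_eq0.
by rewrite -Ew -mulrA E mulr1.
Qed.

(* The coefficients of the additive character as a polynomial in T; those of
   index 0 and #|L| - 1 separate the trivial character from the indicator of 0. *)
Definition coef (r : nat) : K :=
  if r == 0%N then 1 else if r == Q1 then - (#|L|%:R / Q1%:R) else gauss r / Q1%:R.

(** At 0 only the constant term survives. At nonzero [x] this is Fourier inversion on the cyclic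
    unit group: terms with [y != x] give a vanishing geometric sum in [T (y^-1 * x)]. *)
Lemma addchar_expand x : Psi x = \sum_(r < #|L|) coef r * T x ^+ r.
Proof.
have Q10 := pred_card_neq0 R.
have recl (F : nat -> K) : \sum_(r < Q1) F r = F 0%N + \sum_(r < Q1.-1) F r.+1.
  by case: Q1 Q1_gt0 => // n _; rewrite big_ord_recl.
rewrite card_L big_ord_recr (recl (fun r => coef r * T x ^+ r)) /=.
have [->|x0] := eqVneq x 0.
  rewrite addchar0 (Teich0 TM redT) mulr1 big1 => [|i _]; last by rewrite expr0n /= mulr0.
  by rewrite expr0n eqn0Ngt Q1_gt0 /= mulr0 !addr0.
rewrite -[T x ^+ Q1](TeichX TM redT) expf_card_pred // (Teich1 TM redT) !mulr1.
transitivity (\sum_(r < Q1) gauss r / Q1%:R * T x ^+ r).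
  under eq_bigr => r _ do rewrite /gauss mulrAC mulr_suml mulr_suml.
  rewrite exchange_big /= (bigD1 x) //= [X in _ + X]big1 ?addr0 => [|y /andP[y0 yx]].
    rewrite (eq_bigr (fun _ => Psi x / Q1%:R)) => [|i _].
      by rewrite sumr_const card_ord -[RHS]mulr_natr divfK.
    have tt : T x^-1 ^+ i * T x ^+ i = 1.
      by rewrite -exprMn -TM mulVf // (Teich1 TM redT) expr1n.
    by rewrite [T _ ^+ i * _]mulrC -!mulrA [X in _ * X]mulrA tt mul1r.
  rewrite (eq_bigr (fun r : 'I_Q1 => Psi y / Q1%:R * T (y^-1 * x) ^+ r)) => [|r _].
    rewrite -mulr_sumr; set t := T _.
    have t1 : t - 1 != 0.
      rewrite subr_eq0 /t (Teich_eq1 TM redT) -(inj_eq (mulfI y0)) mulr1 mulVKf //.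
      by rewrite eq_sym.
    suff ->: \sum_(i < Q1) t ^+ i = 0 by rewrite mulr0.
    apply: (mulfI t1); rewrite -subrX1 mulr0 /t -(TeichX TM redT) expf_card_pred.
      by rewrite (Teich1 TM redT) subrr.
    by rewrite mulf_neq0 ?invr_eq0.
  by rewrite TM exprMn; ring.
rewrite (recl (fun r => gauss r / Q1%:R * T x ^+ r)) /= expr0 mulr1 gauss0.
(* The two extreme coefficients combine to 1 - Q/(Q-1) = -1/(Q-1), the Fourier coefficient at 0. *)
rewrite [RHS]addrAC /coef eqxx eqn0Ngt Q1_gt0 /= eqxx; congr (_ + _).
  have -> : #|L|%:R = Q1%:R + 1 :> K by rewrite natr1 -card_L.
  by field.
apply: eq_bigr => i _; rewrite ltn_eqF //.
by have := ltn_ord i; rewrite -ltnS prednK.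
Qed.

Lemma coef_val r : (r < #|L|)%N ->
  exists w u, [/\ R w u, u != 0 & coef r = pi ^+ digsum p r * w].
Proof.
move=> rQ; rewrite /coef; have N1 : (-1 : L) != 0 by rewrite oppr_eq0 oner_eq0.
have RQ : R Q1%:R^-1 (-1)^-1.
  by apply: redV => //; rewrite -(natr_pred_card L); apply: red_nat.
have N1V : (-1 : L)^-1 != 0 by rewrite invr_eq0.
have [->|r0] := eqVneq r 0%N.
  exists 1, 1; rewrite digsum0 mulr1 oner_neq0; split=> //; exact: red1.
(* Here Q = p^f has valuation f(p-1), which is the digit sum of Q - 1. *)
have [->|rQ1] := eqVneq r Q1.
  have [eta Eeta Reta] := p_pi_expE.
  exists (- (eta ^+ f * Q1%:R^-1)), (- ((-1) ^+ f * (-1)^-1)); split.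
  - by apply: redN; apply: redM => //; apply: redX.
  - by rewrite oppr_eq0 mulf_neq0 // expf_neq0.
  have Edig : (digsum p Q1 = (p - 1) * f)%N.
    rewrite -[LHS]add0n -{1}(digsum0 p) mulnC; apply: digsum_compl.
      exact: prime_gt1.
    by rewrite add0n -card_L.
  by rewrite Edig exprM mulrN mulrA -exprMn -Eeta -natrX -cardL.
have rlt : (0 < r < Q1)%N by rewrite lt0n r0 ltn_neqAle rQ1 -ltnS -card_L.
have [w [u [Rw u0 Ew]]] := gauss_val rlt.
exists (w / Q1%:R), (u / -1); split; first exact: redM.
  by rewrite mulf_neq0.
by rewrite Ew mulrA.
Qed.

End GaussSums.

(** * Orthogonality relations *)

Section ReducedPolynomials.
Variables (K : fieldType) (L : finFieldType) (R : place K L) (T : L -> K).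
Hypotheses (TM : {morph T : x y / x * y}) (redT : forall x, R (T x) x).

Local Notation Q1 := (#|L|.-1).

Let Q1_gt0 : (0 < Q1)%N.
Proof. by rewrite -subn1 subn_gt0 card_finRing_gt1. Qed.
Let card_L : #|L| = Q1.+1.
Proof. by rewrite prednK // ltnW // card_finRing_gt1. Qed.

(** The dual basis of the monomials of degree below [#|L|], for the pairing that sums products of
    functions over [L]. *)
Definition dual_monomial (a : nat) (x : L) : L :=
  if a == 0%N then (x == 0)%:R else - x ^+ (Q1 - a).

Lemma dual_monomialE a b : (a < #|L|)%N -> (b < #|L|)%N ->
  \sum_x dual_monomial a x * x ^+ b = (a == b)%:R.
Proof.
rewrite card_L !ltnS /dual_monomial => aQ bQ.
have [->|a0] := eqVneq a 0%N.
  rewrite (bigD1 0) //= eqxx mul1r expr0n big1 ?addr0 1?eq_sym // => x x0.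
  by rewrite (negPf x0) mul0r.
under eq_bigr do rewrite mulNr -exprD.
rewrite sumrN (bigD1 0) //= (power_sum TM redT) expr0n addn_eq0 subn_eq0.
(* For [a = Q1] and [b = 0], the convention 0^0 = 1 adds a term at [x = 0] that cancels the power
   sum -1. *)
have [E|n0] := eqVneq (Q1 - a + b)%N 0%N.
  rewrite E dvdn0.
  have -> : a = Q1 by lia.
  have -> : b = 0%N by lia.
  by rewrite leqnn eqxx subrr oppr0 eqn0Ngt Q1_gt0.
have -> : (Q1 <= a)%N && (b == 0%N) = false.
  by apply/negbTE; apply: contra n0; rewrite -subn_eq0 => /andP[/eqP-> /eqP->].
rewrite add0r; have [->|ab] := eqVneq a b.
  by rewrite subnK // dvdnn opprK.
(* The exponent lies strictly between 0 and [2 * Q1], so it could only be [Q1], forcing [a = b]. *)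
rewrite ifN ?oppr0 //; apply/negP=> /dvdnP[c Ec].
have c0 : (0 < c)%N by rewrite lt0n; apply/eqP=> c0; move: n0; rewrite Ec c0 mul0n.
have a1 : (0 < a)%N by rewrite lt0n.
have c2 : (c < 2)%N.
  by rewrite -(ltn_pmul2r Q1_gt0) -Ec; move: Q1_gt0 aQ bQ a1; move: Q1 => N; lia.
have c1 : c = 1%N by lia.
by move/eqP: ab Ec; rewrite c1 mul1n; move: aQ; move: Q1 => N; lia.
Qed.

(** Pairing with the product of the dual monomials of [r0] recovers the coefficient [u r0] from the
    values of the polynomial. *)
Lemma reduced_poly_neq0 k (u : {ffun 'I_k -> 'I_#|L|} -> L) r0 : u r0 != 0 ->
  exists a : {ffun 'I_k -> L}, \sum_r u r * \prod_i a i ^+ r i != 0.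
Proof.
move=> ur0; apply/existsP; apply: contraNT ur0 => /existsPn H.
have <- : \sum_(a : {ffun 'I_k -> L}) (\prod_i dual_monomial (r0 i) (a i)) *
    (\sum_r u r * \prod_i a i ^+ r i) = u r0.
  under eq_bigr => a _ do rewrite mulr_sumr.
  rewrite exchange_big /= (bigD1 r0) //= [X in _ + X]big1 ?addr0 => [|r rr0].
    under eq_bigr => a _ do rewrite mulrCA -big_split /=.
    rewrite -mulr_sumr -(bigA_distr_bigA (fun i x => dual_monomial (r0 i) x * x ^+ r0 i)) /=.
    by rewrite big1 ?mulr1 // => i _; rewrite dual_monomialE // eqxx.
  under eq_bigr => a _ do rewrite mulrCA -big_split /=.
  rewrite -mulr_sumr -(bigA_distr_bigA (fun i x => dual_monomial (r0 i) x * x ^+ r i)) /=.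
  have [i ri] : exists i, r0 i != r i.
    by apply/existsP; apply: contraNT rr0 => /existsPn E; apply/eqP/ffunP=> i;
       apply/eqP; rewrite eq_sym -[_ == _]negbK; apply: E.
  rewrite (bigD1 i) //= dual_monomialE // (_ : (nat_of_ord _ == _) = false).
    by rewrite mul0r mulr0.
  by apply/negbTE.
apply/eqP; apply: big1 => a _; have := H a; rewrite negbK => /eqP->.
by rewrite mulr0.
Qed.

End ReducedPolynomials.

Lemma grp_char_sum (K : fieldType) h (n : 'I_h -> nat) (theta : 'I_h -> K) :
  (forall l, theta l ^+ n l = 1) ->
  \sum_(j : grp n) \prod_l theta l ^+ j l =
  if [forall l, theta l == 1] then #|grp n|%:R else 0.
Proof.
move=> theta_n; case: ifPn => [/forallP theta1|/forallPn[l0 theta_l0]].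
  rewrite (eq_bigr (fun _ => 1)) ?sumr_const // => j _.
  by apply: big1 => l _; rewrite (eqP (theta1 l)) expr1n.
(* A cyclic shift of coordinate [l0] multiplies the sum by [theta l0], which is not 1; wrapping
   around is harmless since [theta l0 ^+ n l0 = 1]. *)
pose shift (j : grp n) : grp n := [ffun l => if l == l0 then ordS (j l) else j l].
have shift_inj : injective shift.
  move=> j j' /ffunP E; apply/ffunP=> l; have := E l; rewrite !ffunE.
  by case: ifP => // _ /ordS_inj.
have theta0 : theta l0 - 1 != 0 by rewrite subr_eq0.
apply: (mulfI theta0); rewrite mulr0 mulrBl mul1r; apply/eqP.
rewrite subr_eq0; apply/eqP; rewrite [RHS](reindex_inj shift_inj) mulr_sumr.
apply: eq_bigr => j _; rewrite (bigD1 l0) //= [RHS](bigD1 l0) //= mulrA.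
congr (_ * _); last first.
  by apply: eq_bigr => l ll0; rewrite ffunE (negPf ll0).
by rewrite ffunE eqxx /= expr_mod // exprS.
Qed.

Lemma card_grp_ndvd p h (n : 'I_h -> nat) : prime p ->
  (forall l, ~~ (p %| n l)%N) -> ~~ (p %| #|grp n|)%N.
Proof.
move=> p_pr ndvd; rewrite card_dep_ffun /image_mem.
elim: (enum_mem _) => [|l r IH] /=; first by rewrite dvdn1 gtn_eqF // prime_gt1.
by rewrite Euclid_dvdM // negb_or card_ord ndvd.
Qed.

(** * The subfield of order q and its trace *)

Section Subfield.
Variables (p e m : nat) (K : fieldType) (L : finFieldType) (R : place K L).
Variables (T : L -> K) (eps : K).
Hypotheses (p_pr : prime p) (e_gt0 : (0 < e)%N) (cardL : #|L| = (p ^ (m * e))%N).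
Hypotheses (TM : {morph T : x y / x * y}) (redT : forall x, R (T x) x).
Hypotheses (eps_p : eps ^+ p = 1) (eps_neq1 : eps != 1) (red_eps : R eps 1).

Local Notation q := (p ^ e)%N.
Local Notation Q1 := (#|L|.-1).
Local Notation Psi := (addchar p (m * e) eps).

Definition Fq : {set L} := [set y | y ^+ q == y].

Let q_gt1 : (1 < q)%N. Proof. by rewrite -(expn0 p) ltn_exp2l ?prime_gt1. Qed.

Lemma dvdn_pred_q_card : (q - 1 %| Q1)%N.
Proof. by rewrite cardL mulnC expnM predn_exp subn1 dvdn_mulr. Qed.

Lemma Fq_neq0 y : y != 0 -> (y \in Fq) = (y ^+ (q - 1) == 1).
Proof.
move=> y0; rewrite inE -[RHS](inj_eq (mulfI y0)) mulr1 -exprS subn1 prednK //.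
exact: ltnW.
Qed.

(** A suitable power [d] of a generator of the unit group of [L] generates the units of [Fq], which
    turns power sums over [Fq] into geometric sums. *)
Lemma Fq_sum (V : nmodType) (F : L -> V) : exists2 d : L, (q - 1).-primitive_root d &
  \sum_(y in Fq) F y = F 0 + \sum_(i < q - 1) F (d ^+ i).
Proof.
have [g g_prim] := finField_prim_root L.
have d_prim := dvdn_prim_root g_prim dvdn_pred_q_card.
set d := g ^+ _ in d_prim; exists d => //.
have d0 : d != 0.
  apply: contra_eq_neq (prim_expr_order d_prim) => ->.
  by rewrite expr0n subn_eq0 leqNgt q_gt1 eq_sym oner_eq0.
rewrite (bigD1 0) /=; last by rewrite inE expr0n expn_eq0 eqn0Ngt prime_gt0.
congr (_ + _).
have inj : {in xpredT &, injective (fun i : 'I_(q - 1) => d ^+ i)}.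
  move=> i j _ _ /eqP; rewrite (eq_prim_root_expr d_prim) !modn_small //.
  by move/eqP/val_inj.
rewrite -(big_imset F inj) /=; apply: eq_bigl => y.
apply/andP/imsetP=> [[yF y0]|[i _ ->]].
  rewrite Fq_neq0 // in yF; have [i ->] := prim_rootP d_prim (eqP yF).
  by exists i.
have di0 : d ^+ i != 0 by rewrite expf_neq0.
by rewrite Fq_neq0 // -exprM mulnC exprM (prim_expr_order d_prim) expr1n.
Qed.

Lemma card_Fq : #|Fq| = q.
Proof.
have [d _] := Fq_sum (fun _ => 1%N); rewrite -sum1_card => E.
apply: etrans E _; rewrite [X in 1%N + X](_ : _ = q - 1)%N.
  by rewrite [LHS]subnKC // ltnW.
by apply: etrans (sum1_card _) _; rewrite card_ord.
Qed.

Lemma Fq_power_sum a : \sum_(y in Fq) T y ^+ a =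
  if a == 0%N then q%:R else if (q - 1 %| a)%N then (q - 1)%:R else 0.
Proof.
have [->|a0] := eqVneq a 0%N.
  by rewrite (eq_bigr (fun _ => 1)) // sumr_const card_Fq.
have [d d_prim ->] := Fq_sum (fun y => T y ^+ a).
rewrite (Teich0 TM redT) expr0n (negPf a0) add0r.
rewrite (eq_bigr (fun i : 'I_(q - 1) => T (d ^+ a) ^+ i)) => [|i _]; last first.
  by rewrite -!(TeichX TM redT) -!exprM mulnC.
case: ifPn => [dvd|ndvd].
  have -> : T (d ^+ a) = 1.
    by apply/eqP; rewrite (Teich_eq1 TM redT) -(prim_order_dvd d_prim).
  by rewrite (eq_bigr (fun _ => 1)) => [|i _]; rewrite ?expr1n // sumr_const card_ord.
have t1 : T (d ^+ a) - 1 != 0.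
  by rewrite subr_eq0 (Teich_eq1 TM redT) -(prim_order_dvd d_prim).
apply: (mulfI t1); rewrite -subrX1 mulr0 -(TeichX TM redT) -exprM mulnC exprM.
by rewrite (prim_expr_order d_prim) expr1n (Teich1 TM redT) subrr.
Qed.

(** Transitivity of the trace: each Frobenius exponent below [m * e] is uniquely eb + a with a < e
    and b < m. *)
Lemma abstr_tower x : abstr p (m * e) x = \sum_(a < e) trace q m x ^+ (p ^ a) :> L.
Proof.
under eq_bigr => a _ do rewrite /trace (frob_sum p_pr cardL).
rewrite /abstr; elim: (m) => [|m' IH].
  by rewrite mul0n big_ord0 big1 // => a _; rewrite big_ord0.
rewrite mulSnr big_split_ord /= IH -big_split; apply: eq_bigr => a _ /=.
by rewrite big_ord_recr /= -exprM -expnM -expnD [(e * _)%N]mulnC.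
Qed.

Lemma Fq_expr y b : y \in Fq -> y ^+ (q ^ b) = y.
Proof.
rewrite inE => /eqP yq; elim: b => [|b IH]; first by rewrite expn0 expr1.
by rewrite expnSr exprM IH yq.
Qed.

Lemma trace_Fq_mul y x : y \in Fq -> trace q m (y * x) = y * trace q m x.
Proof.
move=> yF; rewrite /trace mulr_sumr; apply: eq_bigr => i _.
by rewrite exprMn Fq_expr.
Qed.

Lemma trace_in_Fq x : trace q m x \in Fq.
Proof.
have m_gt0 : (0 < m)%N.
  by rewrite lt0n; apply/eqP=> m0; have := card_finRing_gt1 L; rewrite cardL m0.
have cL : #|L| = (q ^ m)%N by rewrite cardL mulnC expnM.
rewrite inE /trace (frob_sum p_pr cardL) -(prednK m_gt0).
rewrite big_ord_recr [X in _ == X]big_ord_recl /= -exprM -expnSr prednK // -cL.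
rewrite expf_card expn0 expr1 addrC; apply/eqP; congr (_ + _).
by apply: eq_bigr => i _; rewrite -exprM -expnSr.
Qed.

(** On [Fq] the character y -> Psi(yz) depends only on the relative trace of [z] and is trivial
    exactly when that trace is 0. *)
Lemma Fq_addchar_sum z :
  \sum_(y in Fq) Psi (y * z) = if trace q m z == 0 then q%:R else 0.
Proof.
have FqD y y0 : y0 \in Fq -> (y + y0 \in Fq) = (y \in Fq).
  by rewrite !inE (frobD p_pr cardL) => /eqP->; rewrite (inj_eq (addIr y0)).
have trE y : y \in Fq ->
    abstr p (m * e) (y * z) = \sum_(a < e) (y * trace q m z) ^+ (p ^ a).
  by move=> yF; rewrite abstr_tower trace_Fq_mul.
case: ifPn => [/eqP tr0|tr0].
  rewrite -card_Fq -sumr_const; apply: eq_bigr => y yF; apply/eqP.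
  rewrite (addchar_eq1 p_pr cardL eps_p eps_neq1 red_eps) trE // tr0 mulr0.
  by rewrite big1 // => a _; rewrite frob0.
have lt : (p ^ e.-1 < #|Fq|)%N.
  by rewrite card_Fq ltn_exp2l ?prime_gt1 // prednK.
have [y1 y1F y1_tr] := sum_frob_neq0 p_pr lt.
(* Dividing by the relative trace of [z] makes the absolute trace of the product that of [y1] from
   [Fq], which is nonzero. *)
apply: (@addchar_sum0 p (m * e) K L R eps p_pr cardL eps_p eps_neq1 red_eps Fq (y1 / trace q m z)).
  move=> y; apply: FqD; have := trace_in_Fq z; rewrite !inE => /eqP Ez.
  by move: y1F; rewrite !inE exprMn exprVn Ez => /eqP->.
rewrite trE; last first.
  have := trace_in_Fq z; rewrite !inE => /eqP Ez.
  by move: y1F; rewrite !inE exprMn exprVn Ez => /eqP->.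
by rewrite mulfVK //; rewrite (prednK e_gt0) in y1_tr.
Qed.

End Subfield.

(** * Weights of codewords *)

Section Weights.
Variables (p e m : nat) (K : fieldType) (L : finFieldType) (R : place K L).
Variables (T : L -> K) (eps : K).
Hypotheses (p_pr : prime p) (e_gt0 : (0 < e)%N) (cardL : #|L| = (p ^ (m * e))%N).
Hypotheses (TM : {morph T : x y / x * y}) (redT : forall x, R (T x) x).
Hypotheses (eps_p : eps ^+ p = 1) (eps_neq1 : eps != 1) (red_eps : R eps 1).
Variables (h k : nat) (n : 'I_h -> nat) (gamma : 'I_h -> L) (s : 'I_k -> grp n).
Hypothesis gamma_prim : forall l, (n l).-primitive_root (gamma l).

Local Notation q := (p ^ e)%N.
Local Notation pi := (eps - 1).
Local Notation Psi := (addchar p (m * e) eps).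
Local Notation c_ := (coef p (m * e) T eps).
Local Notation exponents := {ffun 'I_k -> 'I_#|L|}.

Definition trace_codeword (alpha : 'I_k -> L) (j : grp n) : L :=
  trace q m (\sum_(i < k) alpha i * \prod_(l < h) gamma l ^+ (s i l * j l)%N).

Definition admissible_exp (r : exponents) : bool :=
  [&& 0 < \sum_i r i, q - 1 %| \sum_i r i
    & [forall l, n l %| \sum_i r i * s i l]]%N.

Let q_gt1 : (1 < q)%N. Proof. by rewrite -(expn0 p) ltn_exp2l ?prime_gt1. Qed.
Let L_gt0 : (0 < #|L|)%N. Proof. exact: ltnW (card_finRing_gt1 L). Qed.

(** Additivity makes [Psi] a product over [i]; expanding each factor in powers of [T] and
    distributing separates the dependence on [alpha], [y] and [j]. *)
Lemma addchar_codeword_sum alpha (j : grp n) :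
  \sum_(y in Fq p e L)
     Psi (y * \sum_i alpha i * \prod_l gamma l ^+ (s i l * j l)%N) =
  \sum_(r : exponents) (\prod_i (c_ (r i) * T (alpha i) ^+ r i)) *
    ((\sum_(y in Fq p e L) T y ^+ (\sum_i r i)%N) *
     \prod_l (T (gamma l) ^+ (\sum_i r i * s i l)%N) ^+ j l).
Proof.
under [RHS]eq_bigr => r _ do rewrite mulrCA mulr_suml.
rewrite exchange_big /=; apply: eq_bigr => y _.
pose x i := \prod_l gamma l ^+ (s i l * j l)%N.
transitivity (\prod_i Psi (y * (alpha i * x i))).
  rewrite mulr_sumr; apply: (big_morph Psi).
    exact: addcharD.
  exact: (addchar0 p_pr cardL eps_p eps_neq1 red_eps).
under eq_bigr => i _ do
  rewrite (addchar_expand p_pr cardL TM redT eps_p eps_neq1 red_eps).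
rewrite bigA_distr_bigA; apply: eq_bigr => r _ /=.
rewrite -prodrXr mulrCA.
have -> : \prod_l (T (gamma l) ^+ (\sum_i r i * s i l)%N) ^+ j l =
          \prod_i T (x i) ^+ r i.
  under [RHS]eq_bigr => i _ do rewrite (Teich_prod TM redT) -prodrXl.
  rewrite exchange_big /=; apply: eq_bigr => l _.
  rewrite -exprM big_distrl /= -prodrXr; apply: eq_bigr => i _.
  by rewrite (TeichX TM redT) -exprM; congr (_ ^+ _); ring.
rewrite -!big_split /=; apply: eq_bigr => i _.
by rewrite !TM !exprMn; ring.
Qed.

(** The character sums over [Fq] count the zeros of the codeword. Summing over [j] and [y] kills
    every exponent that is neither zero nor admissible. *)
Lemma weight_expand alpha : q%:R * (hweight (trace_codeword alpha))%:R =
  - ((q - 1) * #|grp n|)%:R *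
    \sum_(r | admissible_exp r) \prod_i (c_ (r i) * T (alpha i) ^+ r i).
Proof.
pose z (j : grp n) := \sum_i alpha i * \prod_l gamma l ^+ (s i l * j l)%N.
have sumT (r : exponents) : \sum_(j : grp n) \prod_l (T (gamma l) ^+ (\sum_i r i * s i l)%N) ^+ j l =
    if [forall l, n l %| \sum_i r i * s i l]%N then #|grp n|%:R else 0.
  rewrite grp_char_sum => [|l].
    by under eq_forallb => l do rewrite -(TeichX TM redT) (Teich_eq1 TM redT) -(prim_order_dvd (gamma_prim l)).
  by rewrite exprAC -(TeichX TM redT) (prim_expr_order (gamma_prim l)) (Teich1 TM redT) expr1n.
pose Z := #|[set j | trace_codeword alpha j == 0]|.
have EZ : q%:R * Z%:R = \sum_(j : grp n) \sum_(y in Fq p e L) Psi (y * z j) :> K.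
  under eq_bigr => j _ do
    rewrite (Fq_addchar_sum p_pr e_gt0 cardL eps_p eps_neq1 red_eps).
  rewrite -big_mkcond sumr_const -[RHS]mulr_natr; congr (_ * _%:R).
  by apply: eq_card => j; rewrite !inE.
have ZW : (Z + hweight (trace_codeword alpha) = #|grp n|)%N.
  rewrite /hweight -(cardsC [set j | trace_codeword alpha j == 0]); congr (_ + _)%N.
  by apply: eq_card => j; rewrite !inE.
pose r0 : exponents := [ffun=> Ordinal L_gt0].
have sum0 (r : exponents) : ((\sum_i r i == 0) = (r == r0))%N.
  apply/eqP/eqP=> [E|->]; last by apply: big1 => i _; rewrite ffunE.
  apply/ffunP=> i; rewrite ffunE; apply/val_inj/eqP => /=.
  by rewrite -leqn0 -E (bigD1 i) //= leq_addr.
have: q%:R * Z%:R = q%:R * #|grp n|%:R + ((q - 1) * #|grp n|)%:R *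
    \sum_(r | admissible_exp r) \prod_i (c_ (r i) * T (alpha i) ^+ r i).
  rewrite EZ; under eq_bigr => j _ do rewrite addchar_codeword_sum.
  rewrite exchange_big /=.
  under eq_bigr => r _ do rewrite -!mulr_sumr sumT
    (Fq_power_sum p_pr e_gt0 cardL TM redT) sum0.
  (* The zero exponent yields [q * #|grp n|], which the passage from zeros to weight cancels; every
     other surviving one carries [(q - 1) * #|grp n|]. *)
  rewrite (bigD1 r0) //= eqxx; congr (_ + _).
    rewrite big1 => [|i _]; last by rewrite ffunE /coef /= expr0 mulr1.
    rewrite mul1r ifT //; apply/forallP=> l; rewrite big1 // => i _.
    by rewrite ffunE mul0n.
  rewrite mulr_sumr [RHS]big_mkcond [LHS]big_mkcond; apply: eq_bigr => r _.
  rewrite /admissible_exp lt0n sum0; case: eqP => //= _.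
  by case: ifP => _; case: ifP => _; rewrite ?mul0r ?mulr0 // mulrC natrM.
have -> : (hweight (trace_codeword alpha))%:R = #|grp n|%:R - Z%:R :> K.
  by rewrite -ZW natrD addrAC subrr add0r.
by move=> E; rewrite mulrBr E; ring.
Qed.

Definition total_digsum (r : exponents) : nat := \sum_i digsum p (r i).

Let gamma_neq0 l : gamma l != 0.
Proof.
apply: contra_eq_neq (prim_expr_order (gamma_prim l)) => ->.
by rewrite expr0n eqn0Ngt (prim_order_gt0 (gamma_prim l)) eq_sym oner_eq0.
Qed.

Lemma order_dvd_card l : (n l %| #|L|.-1)%N.
Proof. by rewrite (prim_order_dvd (gamma_prim l)) expf_card_pred ?gamma_neq0. Qed.

(** Each [n l] divides [#|L|.-1], which is -1 in [L], so [p] divides no factor of [#|grp n|]. *)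
Lemma card_grp_neq0 : #|grp n|%:R != 0 :> L.
Proof.
rewrite -(dvdn_pcharf (pchar_finField p_pr cardL)); apply: card_grp_ndvd => // l.
apply/negP=> /dvdn_trans/(_ (order_dvd_card l)); rewrite (dvdn_pcharf (pchar_finField p_pr cardL)).
by rewrite natr_pred_card oppr_eq0 oner_eq0.
Qed.

Lemma admissible_ex : (0 < k)%N -> exists r, admissible_exp r.
Proof.
move=> k_gt0; have Q1_lt : (#|L|.-1 < #|L|)%N by rewrite prednK.
(* One exponent equal to [#|L|.-1] and the others 0: both [q - 1] and every [n l] divide
   [#|L|.-1]. *)
pose i0 := Ordinal k_gt0; pose r : exponents :=
  [ffun i => if i == i0 then Ordinal Q1_lt else Ordinal L_gt0].
have sum_r (F : 'I_k -> nat) : (\sum_i r i * F i = #|L|.-1 * F i0)%N.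
  rewrite (bigD1 i0) //= big1 => [|i ii0]; last by rewrite ffunE (negPf ii0) mul0n.
  by rewrite ffunE eqxx addn0.
have sum_r1 : (\sum_i r i = #|L|.-1)%N.
  by rewrite -[RHS]muln1 -(sum_r (fun _ => 1%N)); apply: eq_bigr => i _; rewrite muln1.
exists r; rewrite /admissible_exp sum_r1 (dvdn_pred_q_card cardL).
rewrite -{1}subn1 subn_gt0 (card_finRing_gt1 L) /=; apply/forallP=> l.
by rewrite sum_r dvdn_mulr ?order_dvd_card.
Qed.

(* q W = pi^M V with V reducing to a nonzero multiple of a reduced polynomial. *)
Lemma weight_val r0 : admissible_exp r0 -> (forall r, admissible_exp r -> total_digsum r0 <= total_digsum r)%N ->
  (forall alpha, exists v u,
     R v u /\ q%:R * (hweight (trace_codeword alpha))%:R = pi ^+ total_digsum r0 * v) /\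
  (exists alpha v u,
     [/\ R v u, u != 0 & q%:R * (hweight (trace_codeword alpha))%:R = pi ^+ total_digsum r0 * v]).
Proof.
move=> r0_adm r0_min.
have Hc (r : 'I_#|L|) :=
  coef_val p_pr cardL TM redT eps_p eps_neq1 red_eps (ltn_ord r).
have [w Hw] := fin_all_exists Hc.
have [u Hu] := fin_all_exists Hw.
pose c : K := - ((q - 1) * #|grp n|)%:R; pose d : L := #|grp n|%:R.
(* Since [q] is 0 in [L], the factor [-(q - 1)] reduces to 1. *)
have Rc : R c d.
  have <- : - ((q - 1) * #|grp n|)%:R = d.
    rewrite natrM natrB ?(ltnW q_gt1) // natrX (pcharf0 (pchar_finField p_pr cardL)).
    by rewrite expr0n eqn0Ngt e_gt0 sub0r mulN1r opprK.
  by apply: redN; apply: red_nat.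
pose V (alpha : 'I_k -> L) := c * \sum_(r | admissible_exp r)
  (pi ^+ (total_digsum r - total_digsum r0) * \prod_i (w (r i) * T (alpha i) ^+ r i)).
pose U (r : exponents) : L :=
  if admissible_exp r && (total_digsum r == total_digsum r0) then \prod_i u (r i) else 0.
pose v (alpha : 'I_k -> L) := d * \sum_r U r * \prod_i alpha i ^+ r i.
have RV alpha : R (V alpha) (v alpha).
  apply: redM => //; rewrite [X in R X _]big_mkcond; apply: red_sum => r _.
  rewrite /U; case: ifP => [r_adm|_]; last by rewrite mul0r; apply: red0.
  have Rprod : R (\prod_i (w (r i) * T (alpha i) ^+ r i)) (\prod_i u (r i) * \prod_i alpha i ^+ r i).
    rewrite -big_split; apply: red_prod => i _.
    by have [Rw _ _] := Hu (r i); apply: redM => //; apply: redX.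
  (* Exponents of non-minimal digit sum keep a positive power of pi, which reduces to 0. *)
  have [->|ne] := eqVneq (total_digsum r) (total_digsum r0).
    by rewrite subnn expr0 mul1r.
  rewrite mul0r -(mul0r (\prod_i u (r i) * \prod_i alpha i ^+ r i)).
  apply: redM => //; rewrite (_ : 0 = 0 ^+ (total_digsum r - total_digsum r0) :> L).
    by apply: redX; apply: red_pi.
  by rewrite expr0n subn_eq0 leqNgt ltn_neqAle eq_sym ne r0_min.
have EV alpha : q%:R * (hweight (trace_codeword alpha))%:R = pi ^+ total_digsum r0 * V alpha.
  rewrite weight_expand /V mulrCA -/c; congr (_ * _); rewrite mulr_sumr.
  apply: eq_bigr => r r_adm; rewrite mulrA -exprD subnKC ?r0_min //.
  rewrite -prodrXr -big_split; apply: eq_bigr => i _ /=.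
  by have [_ _ ->] := Hu (r i); rewrite mulrA.
split=> [alpha|]; first by exists (V alpha), (v alpha).
have U0 : U r0 != 0.
  rewrite /U r0_adm eqxx; apply/prodf_neq0 => i _.
  by have [_ ] := Hu (r0 i).
have [a Ha] := reduced_poly_neq0 TM redT U0.
by exists a, (V a), (v a); split=> //; apply: mulf_neq0 => //; apply: card_grp_neq0.
Qed.

(** Uniqueness of the valuation: pi reduces to 0, so a unit is never a positive power of pi times a
    local element. *)
Lemma pi_exp_inj a b x y u v : R x u -> R y v -> u != 0 -> v != 0 ->
  pi ^+ a * x = pi ^+ b * y -> a = b.
Proof.
wlog le_ab : a b x y u v / (a <= b)%N.
  by case: (leqP a b) => [|/ltnW] le IH Rx Ry u0 v0 E;
    [apply: (IH a b x y u v) | apply/esym/(IH b a y x v u)].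
move=> Rx Ry u0 v0; have pi0 : pi ^+ a != 0 by rewrite expf_neq0 ?pi_neq0.
rewrite -(subnKC le_ab) exprD -mulrA => /(mulfI pi0) E.
have [->|d0] := posnP (b - a); first by rewrite addn0.
have R0 : R (pi ^+ (b - a) * y) (0 ^+ (b - a) * v).
  by apply: redM => //; apply: redX; apply: red_pi.
move: u0; rewrite -E in R0; rewrite (red_fun Rx R0) expr0n eqn0Ngt d0 mul0r.
by rewrite eqxx.
Qed.

Lemma natr_p_neq0 : p%:R != 0 :> K.
Proof.
have [eta -> Reta] := p_pi_expE p_pr eps_p eps_neq1 red_eps.
rewrite mulf_neq0 ?expf_neq0 ?pi_neq0 //.
by apply: red_neq0 Reta _; rewrite oppr_eq0 oner_eq0.
Qed.

(** This brings divisibility in the local ring back to integers: otherwise the prime-to-[p] part of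
    [W] would be a positive power of [p] times a local element and reduce to 0. *)
Lemma red_dvdn t W x u : R x u -> W%:R = p%:R ^+ t * x -> (p ^ t %| W)%N.
Proof.
move=> Rx E; have [->|W0] := posnP W; first exact: dvdn0.
rewrite (pfactor_dvdn _ p_pr W0) leqNgt; apply/negP=> lt.
have [W' cop EW] := pfactor_coprime p_pr W0.
have p0 : p%:R ^+ logn p W != 0 :> K by rewrite expf_neq0 ?natr_p_neq0.
have E' : W'%:R = p%:R ^+ (t - logn p W) * x :> K.
  by apply: (mulfI p0); rewrite mulrA -exprD subnKC ?(ltnW lt) // -E {2}EW natrM natrX mulrC.
have RW : R W'%:R (0 ^+ (t - logn p W) * u).
  rewrite E'; apply: redM => //; apply: redX.
  by rewrite -(pcharf0 (pchar_finField p_pr cardL)); apply: red_nat.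
have := red_fun (red_nat R W') RW; rewrite expr0n subn_eq0 leqNgt lt mul0r => /eqP.
rewrite -(dvdn_pcharf (pchar_finField p_pr cardL)) => pW'.
by move: cop; rewrite prime_coprime // pW'.
Qed.

Lemma code_valuation r0 : admissible_exp r0 -> (forall r, admissible_exp r -> total_digsum r0 <= total_digsum r)%N ->
  exists2 t, total_digsum r0 = ((p - 1) * (e + t))%N & is_padic_valuation p (fun alpha => hweight (trace_codeword alpha)) t.
Proof.
move=> r0_adm r0_min; have [Hall [a [v [u [Rv u0 Ea]]]]] := weight_val r0_adm r0_min.
have [eta Ep Reta] := p_pi_expE p_pr eps_p eps_neq1 red_eps.
have N10 : (-1 : L) != 0 by rewrite oppr_eq0 oner_eq0.
have eta0 : eta != 0 by apply: red_neq0 Reta _.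
have W0 : (0 < hweight (trace_codeword a))%N.
  rewrite lt0n; apply/eqP=> W0; move/eqP: Ea; rewrite W0 mulr0 eq_sym.
  rewrite mulf_eq0 expf_eq0 (negPf (pi_neq0 eps_neq1)) andbF /=.
  by rewrite (negPf (red_neq0 Rv u0)).
have [W' cop EW] := pfactor_coprime p_pr W0.
(* The weight of the extremal codeword fixes [t]. Comparing powers of pi, with p a unit times
   pi^(p-1), also shows that [p - 1] divides the minimal digit sum. *)
set t := logn p _ in EW.
have Et : total_digsum r0 = ((p - 1) * (e + t))%N.
  have RW' : R (eta ^+ (e + t) * W'%:R) ((-1) ^+ (e + t) * W'%:R).
    by apply: redM; [apply: redX | apply: red_nat].
  apply: (pi_exp_inj Rv RW' u0).
    rewrite mulf_neq0 ?expf_neq0 // -(dvdn_pcharf (pchar_finField p_pr cardL)).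
    by rewrite -prime_coprime.
  transitivity (p%:R ^+ (e + t) * W'%:R : K).
    by rewrite -Ea EW natrM !natrX exprD mulrA mulrAC.
  by rewrite Ep exprMn -exprM mulrA.
exists t => //; split=> [alpha|t' Ht'].
  have [v' [u' [Rv' Ev']]] := Hall alpha.
  (* Converting pi^((p-1)(e+t)) back to p^(e+t) costs the unit [eta ^+ (e + t)]; the factor [q]
     absorbs p^e. *)
  have etaX0 : eta ^+ (e + t) != 0 by rewrite expf_neq0.
  apply: (@red_dvdn t _ ((eta ^+ (e + t))^-1 * v') (((-1) ^+ (e + t))^-1 * u')).
    by apply: redM => //; apply: redV; rewrite ?expf_neq0 //; apply: redX.
  have q0 : q%:R != 0 :> K by rewrite natrX expf_neq0 ?natr_p_neq0.
  apply: (mulfI q0); rewrite Ev' mulrA natrX -exprD Ep exprMn -exprM Et.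
  by rewrite -mulrA mulVKf.
by rewrite -(pfactor_dvdn _ p_pr W0).
Qed.

End Weights.

(** * Existence of the lift, and the minimum over all exponents *)

Lemma Teichmuller_exists (K : fieldType) (L : finFieldType) (R : place K L) (w : K) (g : L) :
  w ^+ (#|L|.-1) = 1 -> (#|L|.-1).-primitive_root g -> R w g ->
  exists T : L -> K, {morph T : x y / x * y} /\ forall x, R (T x) x.
Proof.
move=> wQ g_prim Rwg.
(* [T] sends [g ^+ i] to [w ^+ i]; the default value is reached only at [x = 0]. *)
pose T x := if [pick i : 'I_#|L|.-1 | g ^+ i == x] is Some i then w ^+ i else 0.
have g0 : g != 0.
  apply: contra_eq_neq (prim_expr_order g_prim) => ->.
  by rewrite expr0n eqn0Ngt (prim_order_gt0 g_prim) eq_sym oner_eq0.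
have Tg i : T (g ^+ i) = w ^+ i.
  rewrite /T; case: pickP => [j|/(_ (Ordinal (ltn_pmod i (prim_order_gt0 g_prim))))].
    rewrite (eq_prim_root_expr g_prim) => /eqP E.
    by rewrite -(expr_mod j wQ) E expr_mod.
  by rewrite /= (prim_expr_mod g_prim) eqxx.
have Teich0 : T 0 = 0.
  by rewrite /T; case: pickP => // i; rewrite expf_eq0 (negPf g0) andbF.
have gP x : x != 0 -> exists i, x = g ^+ i.
  by move=> x0; have [i ->] := prim_rootP g_prim (expf_card_pred x0); exists i.
exists T; split=> [x y|x]; last first.
  have [->|/gP[i ->]] := eqVneq x 0; first by rewrite Teich0; apply: red0.
  by rewrite Tg; apply: redX.
have [->|/gP[i ->]] := eqVneq x 0; first by rewrite mul0r Teich0 mul0r.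
have [->|/gP[j ->]] := eqVneq y 0; first by rewrite mulr0 Teich0 mulr0.
by rewrite -exprD !Tg exprD.
Qed.

(** A root of unity [z] of order [p * #|L|.-1] reducing to a generator [g] supplies both data:
    [z ^+ p] reduces to [g ^+ p], again a generator, and defines [T]; [z ^+ #|L|.-1] is a primitive
    [p]-th root of unity reducing to 1. *)
Lemma Teichmuller_place p f (L : finFieldType) : prime p -> #|L| = (p ^ f)%N ->
  exists (R : place algC L) (T : L -> algC) (eps : algC),
    [/\ {morph T : x y / x * y}, forall x, R (T x) x, eps ^+ p = 1,
        eps != 1 & R eps 1].
Proof.
move=> p_pr cardL; have [g g_prim] := finField_prim_root L.
have [R [z [z_prim Rz]]] := cyclotomic_place p_pr (pchar_finField p_pr cardL) g_prim.
have gp_prim : (#|L|.-1).-primitive_root (g ^+ p).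
  rewrite (prim_root_exp_coprime _ g_prim) prime_coprime //.
  rewrite (dvdn_pcharf (pchar_finField p_pr cardL)) natr_pred_card oppr_eq0.
  exact: oner_neq0.
have [T [TM redT]] := Teichmuller_exists (w := z ^+ p) (R := R)
  (etrans (esym (exprM _ _ _)) (prim_expr_order z_prim)) gp_prim (redX p Rz).
exists R, T, (z ^+ #|L|.-1); split=> //.
- by rewrite -exprM mulnC (prim_expr_order z_prim).
- rewrite -(prim_order_dvd z_prim) gtnNdvd ?(prim_order_gt0 g_prim) //.
  by rewrite ltn_Pmull ?prime_gt1 ?(prim_order_gt0 g_prim).
by rewrite -(prim_expr_order g_prim); apply: redX.
Qed.

Local Close Scope ring_scope.
Unset Implicit Arguments.

Theorem theorem4p3 (p e q h k m : nat) (n : 'I_h -> nat)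
  (L : finFieldType) (gamma : 'I_h -> L) (s : 'I_k -> grp n) :
  prime p -> 0 < e -> q = p ^ e ->
  (forall l, 0 < n l) ->
  coprime (\big[lcmn/1]_(l < h) n l) q ->
  is_mult_order (\big[lcmn/1]_(l < h) n l) q m ->
  #|L| = q ^ m ->
  (forall l, ((n l).-primitive_root (gamma l))%R) ->
  0 < k ->
  let codeword (alpha : 'I_k -> L) (j : grp n) : L :=
    trace q m (\sum_(i < k) alpha i *
                 \prod_(l < h) gamma l ^+ (s i l * j l)%N)%R in
  let admissible (r : 'I_k -> nat) : Prop :=
    [/\ forall i, r i <= q ^ m - 1,
        0 < \sum_(i < k) r i,
        (q - 1) %| \sum_(i < k) r i &
        forall l : 'I_h, n l %| \sum_(i < k) r i * s i l] in
  let value (r : 'I_k -> nat) : rat :=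
    ((\sum_(i < k) digsum p (r i))%:R / (p - 1)%:R - e%:R)%R in
  exists t : nat,
    is_padic_valuation p (fun alpha => hweight (codeword alpha)) t /\
    (exists r, admissible r /\ (t%:R = value r)%R) /\
    (forall r, admissible r -> (t%:R <= value r)%R).
Proof.
move=> p_pr e_gt0 -> _ _ _ cardq gamma_prim k_gt0 cw adm value.
have cardL : #|L| = p ^ (m * e) by rewrite cardq mulnC expnM.
have [R [T [eps [TM redT eps_p eps_neq1 red_eps]]]] := Teichmuller_place p_pr cardL.
have L_gt1 := card_finRing_gt1 L.
have [r1 r1_adm] := admissible_ex cardL s gamma_prim k_gt0.
(* Exponents bounded by [q ^ m - 1] form a finite type, so the minimum is attained. *)
case: (arg_minnP (@total_digsum p L k) r1_adm) => r0 r0_adm r0_min.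
have [t Et t_val] :=
  code_valuation p_pr e_gt0 cardL TM redT eps_p eps_neq1 red_eps gamma_prim r0_adm r0_min.
have p1_gt0 : (0 < (p - 1)%:R :> rat)%R by rewrite ltr0n subn_gt0 prime_gt1.
have tE : (t%:R = (total_digsum p r0)%:R / (p - 1)%:R - e%:R :> rat)%R.
  rewrite Et natrM mulrAC divff ?gt_eqF // mul1r natrD addrAC subrr add0r //.
exists t; split; first exact: t_val.
split.
  exists (fun i => val (r0 i)); split; last exact: tE.
  have /and3P[r_gt0 r_q /forallP r_n] := r0_adm; split=> // i.
  by rewrite subn1 -cardq -ltnS (prednK (ltnW L_gt1)) ltn_ord.
move=> r [r_le r_gt0 r_q r_n].
have r_lt i : r i < #|L|.
  by rewrite -(prednK (ltnW L_gt1)) ltnS cardq -subn1 r_le.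
pose r' : {ffun 'I_k -> 'I_#|L|} := [ffun i => Ordinal (r_lt i)].
have r'E i : r' i = r i :> nat by rewrite ffunE.
have r'_adm : admissible_exp p e s r'.
  have sumE : \sum_i r' i = \sum_i r i by apply: eq_bigr => i _; rewrite r'E.
  rewrite /admissible_exp sumE r_gt0 r_q /=; apply/forallP=> l.
  by rewrite (eq_bigr (fun i => r i * s i l)) => [|i _]; rewrite ?r_n ?r'E.
rewrite tE lerD2r ler_pM2r ?invr_gt0 // ler_nat.
apply: leq_trans (r0_min r' r'_adm) _.
by rewrite /total_digsum (eq_bigr (fun i => digsum p (r i))) // => i _; rewrite r'E.
Qed.
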